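(* Let $\mathcal{L}=\{\mathcal{M}_1,\dots,\mathcal{M}_k\}$ be a $k$-set of partition matroids on the same finite ground set $V$, and let $w\in\mathbb{R}^V_{\ge 0}$. Then $$\bar{\tau}^*_w(\mathcal{L})\le(k-1)\,\bar{\nu}_w(\mathcal{L}).$$
   Context: A matroid is identified with the family of its independent sets. Given a partition $(P_1,\dots,P_m)$ of $V$, the associated partition matroid is the family of all subsets of $V$ meeting each $P_i$ in at most one element. For $f\in\mathbb{R}^V$ and $S\subseteq V$ write $f[S]=\sum_{v\in S}f(v)$. $\bar{\nu}_w(\mathcal{L})=\max\{w[S]:S\in\bigcap_{i=1}^k\mathcal{M}_i\}$. For a matroid $\mathcal{M}$ on $V$ and $A\subseteq V$, $\mathrm{span}_{\mathcal{M}}(A)=A\cup\{x\in V:\{x\}\cup S\notin\mathcal{M}\text{ for some }S\in\mathcal{M}\text{ with }S\subseteq A\}$. For $f:V\to\mathbb{R}$ the $\mathcal{M}$-span of $f$ is the function $f^{\mathcal{M}}(v)=\max_{T\subseteq V:\,v\in\mathrm{span}_{\mathcal{M}}(T)}\min_{u\in T}f(u)$. A matroidal fractional $w$-cooperative cover is a $k$-tuple $(f_1,\dots,f_k)$ of functions in $\mathbb{R}^V_{\ge 0}$ with $\sum_{i=1}^kf_i^{\mathcal{M}_i}(v)\ge w(v)$ for every $v\in V$, and $\bar{\tau}^*_w(\mathcal{L})$ is the minimum of $\sum_{i=1}^kf_i[V]$ over all of them.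
   Formalization: The formal statement assumes k ≥ 2: for k = 1 the inequality fails (V={v}, w(v)=1 gives 1 ≤ 0), and for k = 0 with w ≠ 0 no cover exists, so the minimum is undefined. *)

(* Defs.v *)
From mathcomp Require Import all_boot all_order all_algebra.
From mathcomp Require Import all_classical all_reals all_analysis.

Set Implicit Arguments.
Unset Strict Implicit.
Unset Printing Implicit Defensive.

Import Order.TTheory GRing.Theory Num.Theory.
Import numFieldNormedType.Exports.

Local Open Scope ring_scope.

Section Definitions.
Variables (R : realType) (V : finType).

(* A matroid is given by its family of independent sets. *)
Definition partition_matroid (P : {set {set V}}) : {set {set V}} :=
  [set S : {set V} | [forall B in P, (#|S :&: B| <= 1)%N]]%SET.

(* [partition] asks for nonempty blocks; empty blocks would not change the
   matroid. *)
Definition is_partition_matroid (M : {set {set V}}) : Prop :=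
  exists2 P : {set {set V}}, finset.partition P [set: V]%SET & M = partition_matroid P.

Definition matroid_span (M : {set {set V}}) (A : {set V}) : {set V} :=
  A :|: [set x : V | [exists S in M, (S \subset A) && (x |: S \notin M)]]%SET.

(* The minimum over an empty T is +oo; it occurs only when v is a loop, so never
   for a partition matroid. The maximum ranges over a nonempty family. *)
Definition fspan (M : {set {set V}}) (f : V -> R) (v : V) : \bar R :=
  \big[maxe/-oo%E]_(T : {set V} | v \in matroid_span M T)
    \big[mine/+oo%E]_(u in T) (f u)%:E.

Variable k : nat.
Implicit Types (L : 'I_k -> {set {set V}}) (w : V -> R) (f : 'I_k -> V -> R).

Definition cover_weight f : R := \sum_(i < k) \sum_(v : V) f i v.

Definition cooperative_cover L w f : Prop :=
  (forall i v, 0 <= f i v) /\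
  (forall v, ((w v)%:E <= \sum_(i < k) fspan (L i) (f i) v)%E).

(* This infimum is a minimum: see [tau_bar_min]. *)
Definition tau_bar L w : R :=
  inf [set cover_weight f | f in [set f | cooperative_cover L w f]]%classic.

(* The default value 0 is the weight of the empty set, which is independent in
   every matroid. *)
Definition nu_bar L w : R :=
  \big[Num.max/0]_(S : {set V} | [forall i, S \in L i]) \sum_(v in S) w v.

End Definitions.

Section Minimum.
Variables (R : realType) (V : finType).

Lemma fspan_ge (M : {set {set V}}) (f : V -> R) v : ((f v)%:E <= fspan M f v)%E.
Proof.
rewrite /fspan (bigD1 [set v]%SET) /=; last by rewrite !inE eqxx.
by rewrite big_set1 le_max lexx.
Qed.

Lemma fspan_le_shift (M : {set {set V}}) (f g : V -> R) (e : R) v :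
  (forall u, g u <= f u + e) -> (fspan M g v <= fspan M f v + e%:E)%E.
Proof.
move=> gf; rewrite /fspan; apply/bigmax_leP; split=> [|T vT]; first exact: leNye.
apply: (@le_trans _ _ (\big[mine/+oo%E]_(u in T) (f u)%:E + e%:E)%E); last first.
  by rewrite leeD2r// (le_bigmax_cond _ (fun T : {set V} => \big[mine/+oo%E]_(u in T) (f u)%:E)).
rewrite -leeBlDr//; apply/bigmin_geP; split=> [|u uT]; first by rewrite leey.
rewrite leeBlDr// -EFinD; apply: (@le_trans _ _ (g u)%:E); last by rewrite lee_fin.
exact: bigmin_le_cond.
Qed.

Variables (k : nat) (L : 'I_k -> {set {set V}}) (w : V -> R).
Hypotheses (k_gt0 : (0 < k)%N) (w_ge0 : forall v, 0 <= w v).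

Let cover_ex : exists f, cooperative_cover L w f.
Proof.
exists (fun _ => w); split=> // v.
rewrite (bigD1 (Ordinal k_gt0))//= -[leLHS]adde0; apply: leeD; first exact: fspan_ge.
by apply: sume_ge0 => i _; apply: le_trans (fspan_ge _ _ _); rewrite lee_fin.
Qed.

Let X := prod_topology (fun _ : 'I_k * V => R : topologicalType).

Let cover_closed : closed
  [set x : X | forall v,
    ((w v)%:E <= \sum_(i < k) fspan (L i) (fun u => x (i, u)) v)%E]%classic.
Proof.
move=> x clx v; apply/lee_addgt0Pr => e e0.
pose d := e / k%:R.
have d0 : 0 < d by rewrite divr_gt0// ltr0n.
have /clx[y [/(_ v) yv /= yx]] :
    nbhs x [set y : X | forall p, y p < x p + d]%classic.
  apply: (@filter_forall X _ (fun p => [set y : X | y p < x p + d]%classic) (nbhs x)) => p.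
  apply: (@proj_continuous _ (fun _ : 'I_k * V => R : topologicalType) p x
    [set z : R | z < x p + d]%classic).
  by apply: lt_nbhsl; rewrite ltrDl.
apply: (le_trans yv).
have -> : e%:E = (\sum_(i < k) d%:E)%E.
  rewrite sumEFin sumr_const card_ord -mulr_natr divfK//.
  by rewrite pnatr_eq0 -lt0n.
rewrite -big_split/=; apply: lee_sum => i _.
by apply: fspan_le_shift => u; apply: ltW.
Qed.

Lemma tau_bar_min :
  (exists2 f, cooperative_cover L w f & cover_weight f = tau_bar L w) /\
  (forall f, cooperative_cover L w f -> tau_bar L w <= cover_weight f).
Proof.
have [f0 cf0] := cover_ex.
pose c := cover_weight f0.
pose A : set X := ([set x : X | forall p, `[0%R, c]%classic (x p)] `&`
  [set x : X | forall v,
    ((w v)%:E <= \sum_(i < k) fspan (L i) (fun u => x (i, u)) v)%E])%classic.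
have cA : compact A.
  apply: compact_closedI cover_closed.
  apply: (@tychonoff _ (fun _ : 'I_k * V => R : topologicalType)
    (fun _ => `[0%R, c]%classic)) => p.
  exact: segment_compact.
pose F (x : X) := \sum_(p : 'I_k * V) x p.
have cF : continuous F.
  apply: continuous_big => [|p _].
    exact: (@add_continuous R).
  exact: (@proj_continuous _ (fun _ : 'I_k * V => R : topologicalType) p).
have FE f : F (fun p => f p.1 p.2) = cover_weight f.
  by rewrite /F /cover_weight pair_big.
have inA f : cooperative_cover L w f -> cover_weight f <= c ->
    A (fun p => f p.1 p.2).
  move=> [f_ge0 fw] fc; split=> //= -[i v]; rewrite /= in_itv/= f_ge0/=.
  apply: le_trans fc; rewrite -FE /F (bigD1 (i, v))//= lerDl.
  exact: sumr_ge0.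
have A0 : (A !=set0)%classic by eexists; exact: (inA f0).
have [x /set_mem[xc xw] xmin] :=
  compact_EVT_min A0 cA (continuous_subspaceT cF).
pose f i v := x (i, v).
have cf : cooperative_cover L w f.
  by split=> // i v; have := xc (i, v); rewrite /= in_itv/= => /andP[].
have fE : cover_weight f = F x.
  by rewrite -FE /F; apply: eq_bigr => -[].
have fmin g : cooperative_cover L w g -> cover_weight f <= cover_weight g.
  move=> cg; have [gc|/ltW cg'] := leP (cover_weight g) c.
    by rewrite fE -[leRHS]FE; apply/xmin/mem_set/inA.
  apply: le_trans cg'; rewrite fE /c -FE; apply/xmin/mem_set.
  exact: inA.
suff tE : cover_weight f = tau_bar L w by split; [exists f|rewrite -tE].
apply/eqP; rewrite eq_le; apply/andP; split.
  apply: lb_le_inf; first by exists (cover_weight f), f.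
  by move=> _ [g cg <-]; exact: fmin.
apply: ge_inf; last by exists f.
by exists (cover_weight f) => _ [g cg <-]; exact: fmin.
Qed.

End Minimum.

(* Main.v *)
Require Import Defs.
From mathcomp Require Import all_boot all_order all_algebra.
From mathcomp Require Import all_classical all_reals all_analysis.
From mathcomp Require Import ring lra.

Import Order.TTheory GRing.Theory Num.Theory.
Local Open Scope ring_scope.

(** In a partition matroid the span of a nonempty set is the union of the
    blocks that it meets, so the span of [f] at [v] is the largest value of [f]
    on the block of [v]. A cooperative cover is therefore a weighted fractional
    vertex cover of the [k]-partite hypergraph whose vertices are the blocks and
    whose edges are the elements of [V], while the sets independent in all the
    matroids are its matchings. The claim becomes the weighted form of Furedi's
    theorem for [k]-partite hypergraphs, due to Furedi, Kahn and Seymour: the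
    fractional cover number is at most [k - 1] times the weighted matching
    number. The proof combines linear programming duality with the local ratio
    method of Chan and Lau.

    By duality ([farkas], used in [fractional_cover]) it suffices to bound the
    weight of a fractional matching [x] by [(k - 1) w(S)] for some matching [S]
    ([rounding]). Suppose that every block met by the support of [x] contains at
    least [k] elements of the support. Then there are at most as many such
    blocks as elements of the support, and their incidence vectors are linearly
    dependent because each of the [k >= 2] parts sums to the all-one vector; so
    some nonzero vector sums to zero on every block ([balanced_vector]), and
    moving [x] along it shrinks the support without losing weight
    ([shrink_support]). So one may assume that the support is empty or that some
    block meets it in at least one and fewer than [k] elements. In the latter
    case the element [m] of this intersection with the largest value [x m]
    is in conflict with elements of total [x]-value at most [k - 1]
    ([light_neighbourhood]).

    Now subtract [w m] from the weights of all elements in conflict with [m]. This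
    loses at most [(k - 1) w m] of the weight of [x]. By induction a matching
    [S] accounts for the remaining weights; either [S] already meets the
    neighbourhood of [m], or [m] can be added to it, and in both cases it
    regains [w m]. *)

Set Implicit Arguments.
Unset Strict Implicit.

(** * Linear algebra *)

Section Farkas.
Variables (R : realFieldType) (J : eqType).

Lemma between_bounds (I : finType) (P Q : pred I) (u l : I -> R) :
  (forall p q, P p -> Q q -> l q <= u p) ->
  exists t, (forall p, P p -> t <= u p) /\ (forall q, Q q -> l q <= t).
Proof.
move=> lu; case: (pickP P) => [p0 Pp0|P0].
  case: (@arg_minP _ _ _ p0 P u Pp0) => p Pp pmin.
  by exists (u p); split=> // q Qq; apply: lu.
case: (pickP Q) => [q0 Qq0|Q0].
  case: (@arg_maxP _ _ _ q0 Q l Qq0) => q Qq qmax.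
  by exists (l q); split=> // p; rewrite P0.
by exists 0; split=> i; rewrite ?P0 ?Q0.
Qed.

(** Farkas' lemma by Fourier-Motzkin elimination of the variables one by one.
    The eliminated system is given by a nonnegative matrix of multipliers, so a
    certificate of its infeasibility pulls back to the original system by
    composition. *)
Lemma farkas (s : seq J) (I : finType) (a : I -> J -> R) (b : I -> R) :
  uniq s ->
  (exists x : J -> R, forall i, \sum_(j <- s) a i j * x j <= b i) \/
  (exists y : I -> R, [/\ forall i, 0 <= y i,
     forall j, j \in s -> \sum_i y i * a i j = 0 & \sum_i y i * b i < 0]).
Proof.
elim: s I a b => [|j0 s IH] I a b => [_|/= /andP[j0s us]].
  case: (pickP (fun i => b i < 0)) => [i0 bi0|b_ge0]; last first.
    by left; exists (fun=> 0) => i; rewrite big_nil leNgt b_ge0.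
  right; exists (fun i => (i == i0)%:R); split=> //.
  rewrite (bigD1 i0) //= eqxx mul1r big1 ?addr0 // => i /negPf ->.
  by rewrite mul0r.
pose c i := a i j0.
(* Each pair of constraints with coefficients of opposite signs is combined so
   that the variable cancels; constraints free of it are kept, and all other
   indices give the trivial constraint 0 <= 0. *)
pose m (r : I + I * I) i : R := match r with
  | inl p => ((c p == 0) && (i == p))%:R
  | inr (p, q) => if (0 < c p) && (c q < 0)
                  then - c q * (i == p)%:R + c p * (i == q)%:R else 0
  end.
have m_ge0 r i : 0 <= m r i.
  case: r => [p|[p q]] /=; first by rewrite ler0n.
  case: ifP => // /andP[cp cq].
  by rewrite addr_ge0 // mulr_ge0 ?ler0n // ?oppr_ge0 ltW.
have sumD p (F : I -> R) : \sum_i (i == p)%:R * F i = F p.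
  rewrite (bigD1 p) //= eqxx mul1r big1 ?addr0 // => i /negPf ->.
  by rewrite mul0r.
have m_pair p q (F : I -> R) : 0 < c p -> c q < 0 ->
    \sum_i m (inr (p, q)) i * F i = - c q * F p + c p * F q.
  move=> cp cq; rewrite /= cp cq /=.
  under eq_bigr do rewrite mulrDl -!mulrA.
  by rewrite big_split /= -!mulr_sumr !sumD.
have m_c r : \sum_i m r i * c i = 0.
  case: r => [p|[p q]].
    rewrite /=; case: eqP => [cp0|_] /=; last by rewrite big1 // => i; rewrite mul0r.
    by rewrite sumD.
  case cpq: ((0 < c p) && (c q < 0)); last first.
    by rewrite /= cpq big1 // => i; rewrite mul0r.
  by case/andP: cpq => cp cq; rewrite m_pair //; ring.
have [[x xP]|[y [y_ge0 ya yb]]] := IH _ (fun r j => \sum_i m r i * a i j)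
  (fun r => \sum_i m r i * b i) us; last first.
  have dbl (F : I -> R) : \sum_i (\sum_r y r * m r i) * F i =
      \sum_r y r * \sum_i m r i * F i.
    under eq_bigr do rewrite mulr_suml.
    rewrite exchange_big /=; apply: eq_bigr => r _; rewrite mulr_sumr.
    by apply: eq_bigr => i _; rewrite mulrA.
  right; exists (fun i => \sum_r y r * m r i); split.
  - by move=> i; apply: sumr_ge0 => r _; rewrite mulr_ge0.
  - move=> j; rewrite dbl inE => /predU1P[->|/ya//].
    by rewrite big1 // => r _; rewrite m_c mulr0.
  - by rewrite dbl.
left; pose S i := \sum_(j <- s) a i j * x j.
have mS r : \sum_i m r i * S i <= \sum_i m r i * b i.
  apply: le_trans (xP r); rewrite le_eqVlt; apply/orP; left; apply/eqP.
  under eq_bigr do rewrite mulr_sumr.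
  rewrite exchange_big /=; apply: eq_bigr => j _; rewrite mulr_suml.
  by apply: eq_bigr => i _; rewrite mulrA.
have [|t [tu tl]] := @between_bounds I (fun p => 0 < c p) (fun q => c q < 0)
    (fun p => (b p - S p) / c p) (fun q => (b q - S q) / c q).
  move=> p q cp cq; have := mS (inr (p, q)); rewrite !m_pair // => h.
  rewrite -[leLHS]mulrNN -invrN ler_pdivrMr ?oppr_gt0 // mulrAC ler_pdivlMr //.
  by lra.
exists (fun j => if j == j0 then t else x j) => i.
rewrite big_cons eqxx (_ : \sum_(j <- s) _ = S i); last first.
  apply: eq_big_seq => j js; case: eqP => // jj0.
  by rewrite -jj0 js in j0s.
rewrite -/(c i); have [ci|ci|ci0] := ltgtP (c i) 0.
- have := tl i ci; rewrite ler_ndivrMr // mulrC; lra.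
- have := tu i ci; rewrite ler_pdivlMr // mulrC; lra.
- have := mS (inl i); rewrite /= ci0 eqxx !sumD mul0r add0r //.
Qed.
End Farkas.

(** Fewer equations than unknowns; the family is indexed by arbitrary finite
    sets so that the solution can be taken supported on [S]. *)
Lemma kernel_vector (R : fieldType) (V J : finType) (a : J -> V -> R)
    (S : {set V}) (Q : {set J}) : (#|Q| < #|S|)%N ->
  exists z : V -> R, [/\ exists v, z v != 0, forall v, v \notin S -> z v = 0 &
    forall q, q \in Q -> \sum_v a q v * z v = 0].
Proof.
move=> QS; pose M := \matrix_(i < #|S|, j < #|Q|) a (enum_val j) (enum_val i).
have : kermx M != 0.
  by rewrite -mxrank_eq0 mxrank_ker subn_eq0 -ltnNge (leq_ltn_trans (rank_leq_col M)).
case/rowV0Pn => u /sub_kermxP uM u0.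
pose z v := if [pick i : 'I_#|S| | enum_val i == v] is Some i then u 0 i else 0.
have zE i : z (enum_val i) = u 0 i.
  by rewrite /z; case: pickP => [j /eqP/enum_val_inj->//|/(_ i)]; rewrite eqxx.
have z0 v : v \notin S -> z v = 0.
  by rewrite /z; case: pickP => // j /eqP <-; rewrite enum_valP.
exists z; split=> // [|q qQ].
  have /existsP[i ui] : [exists i, u 0 i != 0].
    apply: contraNT u0 => /existsPn h; apply/eqP/rowP => i; rewrite mxE.
    by apply/eqP; move: (h i); rewrite negbK.
  by exists (enum_val i); rewrite zE.
rewrite (bigID (fun v => v \in S)) /= [X in _ + X]big1 ?addr0; last first.
  by move=> v /z0 ->; rewrite mulr0.
have enumS (F : V -> R) : \sum_(v in S) F v = \sum_(i < #|S|) F (enum_val i).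
  exact: big_enum_val.
have /matrixP/(_ 0 (enum_rank_in qQ q)) := uM.
rewrite enumS [LHS]mxE [RHS]mxE; apply: etrans; apply: eq_bigr => i _.
by rewrite mxE enum_rankK_in // zE mulrC.
Qed.

(** * Fractional matchings of k-partite hypergraphs *)

Section Hypergraph.
Variables (R : realFieldType) (V C : finType) (k : nat) (c : 'I_k -> V -> C).
Hypothesis k_ge2 : (2 <= k)%N.

(** Here [V] is the set of edges, and [c i v] is the vertex of the edge [v] in
    the [i]-th part; two edges are in conflict when they share a vertex. *)
Definition conflict (u v : V) : bool := [exists i, c i u == c i v].

Definition matching (S : {set V}) : Prop :=
  {in S &, forall u v, conflict u v -> u = v}.

Definition fractional_matching (x : V -> R) : Prop :=
  (forall v, 0 <= x v) /\ (forall i a, \sum_(v | c i v == a) x v <= 1).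

Definition supp (x : V -> R) : {set V} := [set v | x v != 0]%SET.

Lemma conflict_sym u v : conflict u v = conflict v u.
Proof. by apply: eq_existsb => i; rewrite eq_sym. Qed.

Lemma conflictxx v : conflict v v.
Proof. by apply/existsP; exists (Ordinal (ltnW k_ge2)). Qed.

(** With all degrees at least [k], each part has at most [#|S| / k] vertices on
    [S], hence there are at most [#|S|] vertices in all. Dropping one of them
    leaves fewer than [#|S|] equations, and the dropped equation follows from
    the others because the sum over all of [V] can be computed in two different
    parts. *)
Lemma balanced_vector (S : {set V}) : S != finset.set0 ->
  (forall i e, e \in S -> (k <= #|[set v in S | c i v == c i e]%SET|)%N) ->
  exists z : V -> R, [/\ exists v, z v != 0, forall v, v \notin S -> z v = 0 &
    forall i a, \sum_(v | c i v == a) z v = 0].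
Proof.
case/finset.set0Pn => e0 e0S deg.
pose i0 := Ordinal (ltnW k_ge2); pose i1 := Ordinal k_ge2.
pose Q := [set q : 'I_k * C | q.2 \in [set c q.1 v | v in S]]%SET.
pose q0 := (i0, c i0 e0).
have q0Q : q0 \in Q by rewrite inE; apply: imset_f.
(* Double counting, after multiplying by k: a part contributes k times its
   number of vertices, which is at most the sum of their degrees, #|S|. *)
have cardQ : (#|Q| <= #|S|)%N.
  have k0 : (0 < k)%N by apply: ltnW.
  rewrite -(leq_pmul2l k0) -[X in (k * X <= _)%N]sum1_card big_distrr /= muln1.
  have -> : (\sum_(q in Q) k = \sum_(i < k) \sum_(a in [set c i v | v in S]%SET) k)%N.
    rewrite pair_big_dep /=; apply: eq_bigl => q.
    by rewrite inE.
  rewrite -[X in (_ <= X * _)%N]card_ord -sum_nat_const.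
  apply: leq_sum => i _; rewrite -[leqRHS]sum1_card.
  rewrite (partition_big_imset (c i)) /=; apply: leq_sum => a /imsetP[e eS ->].
  apply: leq_trans (deg i e eS) _; rewrite -sum1_card.
  by rewrite leq_eqVlt; apply/orP; left; apply/eqP/eq_bigl => v; rewrite inE.
have cardQ' : (#|Q :\ q0| < #|S|)%N by rewrite (leq_trans _ cardQ) // [leqRHS](cardsD1 q0) q0Q.
have [z [z_neq0 zS zQ]] :=
  @kernel_vector R V _ (fun q v => (c q.1 v == q.2)%:R) S _ cardQ'.
have z0 i a : (i, a) != q0 -> \sum_(v | c i v == a) z v = 0.
  move=> iaq; have [iaQ|iaQ] := boolP ((i, a) \in Q).
    rewrite -[RHS](zQ (i, a)) ?in_setD1 ?iaq //= big_mkcond /=.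
    by apply: eq_bigr => v _; case: ifP; rewrite ?mul1r ?mul0r.
  rewrite big1 // => v /eqP va; apply: zS; apply: contraNN iaQ => vS.
  by rewrite inE /= -va imset_f.
have i10 : i1 != i0 by [].
have sum_all i : \sum_v z v = \sum_a \sum_(v | c i v == a) z v.
  by rewrite (partition_big (c i) predT).
exists z; split=> // i a.
(* The remaining equation: its part sums to the total, which vanishes since all
   equations of the other part i1 are available. *)
have [iaq0|/z0 //] := eqVneq (i, a) q0; case: iaq0 => -> ->.
have : \sum_v z v = 0 by rewrite (sum_all i1) big1 // => a' _; rewrite z0.
rewrite (sum_all i0) (bigD1 (c i0 e0)) //= [X in _ + X]big1 ?addr0 // => a' a'0.
by rewrite z0 // xpair_eqE eqxx.
Qed.

(** Adding a balanced vector keeps all vertex sums, so only nonnegativity limits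
    the step: the longest possible step reaches zero at some element. The sign
    of the vector is chosen so that the weight does not drop. *)
Lemma shrink_support (x w : V -> R) : fractional_matching x ->
  supp x != finset.set0 ->
  (forall i e, e \in supp x -> (k <= #|[set v in supp x | c i v == c i e]%SET|)%N) ->
  exists x', [/\ fractional_matching x', supp x' \proper supp x &
    \sum_v w v * x v <= \sum_v w v * x' v].
Proof.
move=> [x_ge0 x_le1] suppx deg.
have [z [[[v0 zv0] zS zc] wz_ge0]] : exists z : V -> R, [/\ exists v, z v < 0,
    forall v, v \notin supp x -> z v = 0 &
    forall i a, \sum_(v | c i v == a) z v = 0] /\ 0 <= \sum_v w v * z v.
  have [z [[v zv] zS zc]] := balanced_vector suppx deg.
  (* A balanced nonzero vector has a negative entry, and so does its opposite. *)
  have neg (y : V -> R) u : y u != 0 ->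
      (forall i a, \sum_(v | c i v == a) y v = 0) -> exists v, y v < 0.
    move=> yu yc; case: (pickP (fun v => y v < 0)) => [v' yv'|y_ge0]; first by exists v'.
    case/eqP: yu; have /eqP := yc (Ordinal k_ge2) (c (Ordinal k_ge2) u).
    rewrite psumr_eq0 => [/allP/(_ u)|v' _]; last by rewrite leNgt y_ge0.
    by rewrite mem_index_enum eqxx => /(_ isT)/eqP.
  have [wz|/ltW wz] := leP 0 (\sum_v w v * z v).
    by exists z; split=> //; split=> //; apply: neg zv zc.
  exists (fun v => - z v); split.
    split=> [|u /zS ->|i a]; last 2 first.
    - by rewrite oppr0.
    - by rewrite sumrN zc oppr0.
    apply: (neg _ v) => [|i a]; first by rewrite oppr_eq0.
    by rewrite sumrN zc oppr0.
  by under eq_bigr do rewrite mulrN; rewrite sumrN oppr_ge0.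
case: (@arg_minP _ _ _ v0 (fun v => z v < 0) (fun v => x v / - z v) zv0) => m zm mmin.
pose l := x m / - z m.
have l_ge0 : 0 <= l by rewrite divr_ge0 // oppr_ge0 ltW.
exists (fun v => x v + l * z v); split.
- split=> [v|i a].
    have [zv|zv] := leP 0 (z v); first by rewrite addr_ge0 // mulr_ge0.
    have := mmin v zv; rewrite -/l ler_pdivlMr ?oppr_gt0 //; lra.
  by rewrite big_split /= -mulr_sumr zc mulr0 addr0.
- apply/properP; split.
    apply/fintype.subsetP => v; rewrite !inE; apply: contraNN => xv.
    by rewrite (eqP xv) zS ?mulr0 ?addr0 // inE negbK.
  have zm0 : z m != 0 by rewrite lt_eqF.
  exists m; first by apply: contraNT zm0 => /zS ->.
  rewrite inE negbK /l; apply/eqP; field.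
  by rewrite zm0.
- under [leRHS]eq_bigr do rewrite mulrDr mulrCA.
  by rewrite big_split /= -mulr_sumr lerDl mulr_ge0.
Qed.

Lemma sparse_support (x w : V -> R) : fractional_matching x ->
  exists x', [/\ fractional_matching x', supp x' \subset supp x,
    \sum_v w v * x v <= \sum_v w v * x' v &
    supp x' = finset.set0 \/
    exists e i, e \in supp x' /\ (#|[set v in supp x' | c i v == c i e]%SET| < k)%N].
Proof.
move: {2}#|_| (leqnn #|supp x|) => n; elim: n x => [|n IH] x cx fx.
  have x0 : supp x = finset.set0 by apply/eqP; rewrite -cards_eq0 -leqn0.
  by exists x; split=> //; left.
have [x0|x0] := eqVneq (supp x) finset.set0; first by exists x; split=> //; left.
have [h|/existsPn h] :=
  boolP [exists e, (e \in supp x) &&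
     [exists i, (#|[set v in supp x | c i v == c i e]%SET| < k)%N]].
  case/existsP: h => e /andP[ex /existsP[i ei]].
  by exists x; split=> //; right; exists e, i.
have [|y [fy yx wy]] := shrink_support w fx x0.
  move=> i e ex; rewrite leqNgt; apply: contraNN (h e) => ei.
  by rewrite ex; apply/existsP; exists i.
have [|y' [fy' y'y wy' yD]] := IH y _ fy.
  by rewrite -ltnS (leq_trans (proper_card yx)).
exists y'; split=> //; first exact: fintype.subset_trans y'y (proper_sub yx).
exact: le_trans wy wy'.
Qed.

(** Let [m] maximise [x] among the at most [k - 1] support elements on the
    vertex of [e] in part [i], which then carries at most [(k - 1) x m]. Each of the other [k - 1]
    vertices of [m] adds at most [1 - x m], as [m] itself is already counted;
    the total is [k - 1]. *)
Lemma light_neighbourhood (x : V -> R) e i : fractional_matching x ->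
  e \in supp x -> (#|[set v in supp x | c i v == c i e]%SET| < k)%N ->
  exists2 m, m \in supp x & \sum_(v | conflict m v) x v <= k%:R - 1.
Proof.
move=> [x_ge0 x_le1] ex card_e.
pose P v := (v \in supp x) && (c i v == c i e).
have Pe : P e by rewrite /P ex /=.
case: (@arg_maxP _ _ _ e P x Pe) => m /andP[mx /eqP mi] mmax.
exists m => //.
(* F charges a neighbour to every vertex that it shares with m, and m itself
   only to the part i. *)
pose F j v := if (c j m == c j v) && ((j == i) || (v != m)) then x v else 0.
have F_ge0 j v : 0 <= F j v by rewrite /F; case: ifP.
have le_F : \sum_(v | conflict m v) x v <= \sum_j \sum_v F j v.
  rewrite exchange_big /= big_mkcond /=; apply: ler_sum => v _.
  case: ifP => [|_]; last exact: sumr_ge0.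
  move/existsP=> [j jmv].
  have [vm|vm] := eqVneq v m.
    rewrite (bigD1 i) //= {1}/F vm !eqxx /= lerDl; exact: sumr_ge0.
  rewrite (bigD1 j) //= {1}/F jmv vm orbT /= lerDl; exact: sumr_ge0.
apply: (le_trans le_F); rewrite (bigD1 i) //=.
have k1 : k%:R - 1 = (k.-1)%:R :> R.
  by rewrite -{1}(prednK (ltnW k_ge2)) -natr1 addrK.
have Fi : \sum_v F i v <= (k%:R - 1) * x m.
  apply: (@le_trans _ _ (\sum_(v in [set v in supp x | c i v == c i e]%SET) x m)).
    rewrite [leRHS]big_mkcond /=; apply: ler_sum => v _.
    rewrite inE /F eqxx /= andbT mi eq_sym.
    case: ifP => cv; last by case: ifP.
    rewrite andbT; case: ifP => vx; first by apply: mmax; rewrite /P vx.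
    by move: vx; rewrite inE => /eqP ->.
  rewrite sumr_const -[leLHS]mulr_natl k1 ler_wpM2r // ler_nat.
  by rewrite -ltnS (ltn_predK k_ge2).
have Fj : \sum_(j | j != i) \sum_v F j v <= (k%:R - 1) * (1 - x m).
  apply: (@le_trans _ _ (\sum_(j < k | j != i) (1 - x m))).
    apply: ler_sum => j ji; rewrite lerBrDl.
    apply: le_trans (x_le1 j (c j m)).
    rewrite [leRHS](bigD1 m) //= lerD2l.
    rewrite [leRHS]big_mkcond /=; apply: ler_sum => v _.
    by rewrite /F (negPf ji) /= eq_sym.
  rewrite sumr_const -[leLHS]mulr_natl k1; apply: ler_wpM2r.
    rewrite subr_ge0; apply: le_trans (x_le1 i (c i m)).
    rewrite (bigD1 m) //= lerDl; exact: sumr_ge0.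
  by rewrite ler_nat cardC1 card_ord.
lra.
Qed.

(** The local ratio induction. The weights [w] have arbitrary signs because
    subtracting the weight of an element on its whole neighbourhood can make some
    of them negative; the induction is on the number of positive weights, which
    drops since the weight of that element becomes zero. *)
Lemma rounding (x w : V -> R) : fractional_matching x ->
  exists2 S : {set V}, matching S &
    \sum_v w v * x v <= (k%:R - 1) * \sum_(v in S) w v.
Proof.
move: {2}#|_| (leqnn #|[set v | 0 < w v]%SET|) => n.
elim: n w x => [|n IH] w x cw fx; have [x_ge0 x_le1] := fx.
  exists finset.set0; first by move=> u v; rewrite inE.
  rewrite big_set0 mulr0; apply: sumr_le0 => v _.
  rewrite mulr_le0_ge0 // leNgt; apply/negP => wv.
  move: cw; rewrite leqn0 cards_eq0 => /eqP/setP/(_ v).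
  by rewrite !inE wv.
(* Restricting x to the positive weights ensures that the chosen e satisfies
   0 < w e. *)
pose x0 v := if 0 < w v then x v else 0.
have fx0 : fractional_matching x0.
  split=> [v|i a]; first by rewrite /x0; case: ifP.
  apply: le_trans (x_le1 i a); apply: ler_sum => v _.
  by rewrite /x0; case: ifP.
have wx0 : \sum_v w v * x v <= \sum_v w v * x0 v.
  apply: ler_sum => v _; rewrite /x0; case: ltP => // wv.
  by rewrite mulr0 mulr_le0_ge0.
have [y [fy yx0 wy [y0|[e' [i [e'y cy]]]]]] := sparse_support w fx0.
  exists finset.set0; first by move=> u v; rewrite inE.
  rewrite big_set0 mulr0; apply: (le_trans wx0); apply: (le_trans wy).
  rewrite big1 // => v _; have /setP/(_ v) := y0.
  by rewrite !inE => /negbFE/eqP ->; rewrite mulr0.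
have [e ey ney] := light_neighbourhood fy e'y cy.
have we : 0 < w e.
  have /fintype.subsetP/(_ e ey) := yx0.
  by rewrite inE /x0; case: ifP; rewrite ?eqxx.
pose w1 v := if conflict e v then w e else 0.
pose w2 v := w v - w1 v.
have w1_ge0 v : 0 <= w1 v by rewrite /w1; case: ifP => // _; apply: ltW.
have w2e : w2 e = 0 by rewrite /w2 /w1 conflictxx subrr.
have [|S mS wS] := IH w2 y _ fy.
  rewrite -ltnS (leq_trans _ cw) //; apply: proper_card; apply/properP; split.
    apply/fintype.subsetP => v; rewrite !inE => h; apply: lt_le_trans h _.
    by rewrite /w2 gerBl.
  by exists e; rewrite inE // w2e ltxx.
have wE (T : {set V}) : \sum_(v in T) w v = \sum_(v in T) w2 v + \sum_(v in T) w1 v.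
  by rewrite -big_split /=; apply: eq_bigr => v _; rewrite subrK.
have wyE : \sum_v w v * y v <= \sum_v w2 v * y v + (k%:R - 1) * w e.
  rewrite (_ : \sum_v w v * y v = \sum_v w2 v * y v + \sum_v w1 v * y v).
    rewrite lerD2l; rewrite (_ : \sum_v w1 v * y v = w e * \sum_(v | conflict e v) y v).
      by rewrite [leRHS]mulrC ler_wpM2l // ltW.
    rewrite mulr_sumr [RHS]big_mkcond; apply: eq_bigr => v _.
    by rewrite /w1; case: ifP; rewrite ?mul0r.
  by rewrite -big_split /=; apply: eq_bigr => v _; rewrite -mulrDl subrK.
have k_ge1 : 0 <= k%:R - 1 :> R by rewrite subr_ge0 ler1n ltnW.
suff [T mT wT] : exists2 T : {set V}, matching T &
    \sum_(v in S) w2 v + w e <= \sum_(v in T) w v.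
  exists T => //; apply: (le_trans wx0); apply: (le_trans wy).
  apply: (le_trans wyE); apply: le_trans (ler_wpM2l k_ge1 wT).
  by rewrite mulrDr lerD2r.
have [/existsP[u /andP[uS eu]]|/existsPn Se] := boolP [exists u, (u \in S) && conflict e u].
  exists S => //; rewrite wE lerD2l (bigD1 u) //= {1}/w1 eu lerDl.
  exact: sumr_ge0.
have eS u : u \in S -> conflict e u = false.
  by move=> uS; move: (Se u); rewrite uS => /negbTE.
have eNS : e \notin S by apply/negP => /eS; rewrite conflictxx.
exists (e |: S)%SET.
  move=> u v /setU1P[->|uS] /setU1P[->|vS] //.
  - by rewrite eS.
  - by rewrite conflict_sym eS.
  - exact: mS.
rewrite big_setU1 //= [leLHS]addrC lerD2l wE lerDl; exact: sumr_ge0.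
Qed.

(** Linear programming duality: were there no such cover, the Farkas certificate
    would be, up to scaling, a fractional matching heavier than [(k - 1) nu],
    contradicting [rounding]. *)
Lemma fractional_cover (w : V -> R) (nu : R) :
  (forall S, matching S -> \sum_(v in S) w v <= nu) ->
  exists g : 'I_k -> C -> R, [/\ forall i a, 0 <= g i a,
    forall v, w v <= \sum_i g i (c i v) &
    \sum_i \sum_a g i a <= (k%:R - 1) * nu].
Proof.
move=> nuP; pose J := ('I_k * C)%type.
(* The constraint None bounds the total of the cover, inl asks for
   nonnegativity, and inr v for the covering of v. *)
pose A (r : option (J + V)) (j : J) : R := match r with
  | None => 1
  | Some (inl q) => - (j == q)%:R
  | Some (inr v) => - (c j.1 v == j.2)%:R
  end.
pose b (r : option (J + V)) : R := match r with
  | None => (k%:R - 1) * nu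
  | Some (inl q) => 0
  | Some (inr v) => - w v
  end.
have k_ge1 : 0 <= k%:R - 1 :> R by rewrite subr_ge0 ler1n ltnW.
have [[g gP]|[y [y_ge0 yA yb]]] := farkas A b (index_enum_uniq J).
  exists (fun i a => g (i, a)); split=> [i a|v|].
  - have := gP (Some (inl (i, a))); rewrite /= (bigD1 (i, a)) //= eqxx.
    rewrite big1 => [|j /negPf ->]; last by rewrite oppr0 mul0r.
    by rewrite addr0 mulN1r oppr_le0.
  - have := gP (Some (inr v)); rewrite /=.
    under eq_bigr do rewrite mulNr.
    rewrite sumrN lerN2 => /le_trans; apply.
    rewrite le_eqVlt; apply/orP; left; apply/eqP.
    rewrite [LHS](_ : _ = \sum_i \sum_a (c i v == a)%:R * g (i, a)); last first.
      by rewrite pair_big; apply: eq_bigr => -[].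
    apply: eq_bigr => i _; rewrite (bigD1 (c i v)) //= eqxx mul1r.
    by rewrite big1 ?addr0 // => a; rewrite eq_sym => /negPf ->; rewrite mul0r.
  - have := gP None; rewrite /= pair_big /=; apply: le_trans.
    by apply: ler_sum => -[i a] _; rewrite mul1r.
pose x v := y (Some (inr v)); pose t := y None.
have big_opt (F : option (J + V) -> R) :
    \sum_r F r = F None + (\sum_q F (Some (inl q)) + \sum_v F (Some (inr v))).
  rewrite (bigD1 None) //= (reindex_omap Some id) => [|[]//] /=.
  by rewrite (eq_bigl predT) => [|q]; rewrite ?big_sumType //= eqxx.
have x_le i a : \sum_(v | c i v == a) x v <= t.
  have := yA (i, a) (mem_index_enum _); rewrite big_opt /= mulr1 -/t.
  rewrite (bigD1 (i, a)) //= eqxx mulrN1 [X in _ + X + _]big1; last first.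
    by move=> q; rewrite eq_sym => /negPf ->; rewrite oppr0 mulr0.
  rewrite addr0 (_ : \sum_v _ = - \sum_(v | c i v == a) x v).
    have := y_ge0 (Some (inl (i, a))); lra.
  rewrite -sumrN [RHS]big_mkcond; apply: eq_bigr => v _.
  by case: ifP => _; rewrite mulrN ?mulr1 // mulr0 oppr0.
have wx : t * ((k%:R - 1) * nu) < \sum_v w v * x v.
  move: yb; rewrite big_opt /= [X in _ + (X + _)]big1 => [|q _]; last by rewrite mulr0.
  rewrite add0r (_ : \sum_v _ = - \sum_v w v * x v) ?subr_lt0 //.
  by rewrite -sumrN; apply: eq_bigr => v _; rewrite mulrN mulrC.
have t_ge0 : 0 <= t by apply: y_ge0.
(* The multiplier t of the bound on the total is the scaling factor; t = 0
   would force x = 0, because every element lies on some vertex. *)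
have [t0|t_neq0] := eqVneq t 0.
  move: wx; rewrite t0 mul0r big1 ?ltxx // => v _.
  suff -> : x v = 0 by rewrite mulr0.
  apply/eqP; rewrite eq_le y_ge0 andbT -t0.
  apply: le_trans (x_le (Ordinal k_ge2) (c (Ordinal k_ge2) v)).
  by rewrite (bigD1 v) //= lerDl; apply: sumr_ge0 => u _; apply: y_ge0.
have t_gt0 : 0 < t by rewrite lt_neqAle eq_sym t_neq0.
have [|S mS] := @rounding (fun v => x v / t) w.
  split=> [v|i a]; first by rewrite divr_ge0 // y_ge0.
  by rewrite -mulr_suml ler_pdivrMr // mul1r.
under eq_bigr do rewrite mulrA.
rewrite -mulr_suml ler_pdivrMr // leNgt => /negP[].
apply: le_lt_trans wx; rewrite mulrC ler_wpM2l //.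
by rewrite ler_wpM2l // nuP.
Qed.

End Hypergraph.

(** * Covers of partition matroids *)

Section PartitionMatroids.
Variables (R : realType) (V : finType) (P : {set {set V}}).
Hypothesis partP : finset.partition P [set: V]%SET.

Let trivP : finset.trivIset P.
Proof. by case/and3P: partP. Qed.

Let mem_block v : v \in finset.pblock P v.
Proof. by rewrite finset.mem_pblock (finset.cover_partition partP) inE. Qed.

Lemma independent_blocks (S : {set V}) :
  {in S &, forall u v, finset.pblock P u = finset.pblock P v -> u = v} ->
  S \in partition_matroid P.
Proof.
move=> Sinj; rewrite inE; apply/forall_inP => B BP.
apply/card_le1_eqP => u v /setIP[uS uB] /setIP[vS vB]; apply: Sinj => //.
by rewrite !(finset.def_pblock trivP BP).
Qed.

Lemma span_block (u v : V) : u \in finset.pblock P v ->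
  v \in matroid_span (partition_matroid P) [set u]%SET.
Proof.
move=> uv; rewrite !inE; have [//|vu /=] := eqVneq v u.
apply/exists_inP; exists [set u]%SET.
  by apply: independent_blocks => x y; rewrite !inE => /eqP -> /eqP ->.
rewrite fintype.subxx /= inE; apply/forall_inPn; exists (finset.pblock P v).
  by rewrite finset.pblock_mem // (finset.cover_partition partP) inE.
rewrite -ltnNge; suff -> : ((v |: [set u]) :&: finset.pblock P v)%SET = [set v; u]%SET.
  by rewrite cards2 vu.
apply/finset.setIidPl/fintype.subsetP => x; rewrite !inE.
by case/orP=> /eqP->.
Qed.

Lemma fspan_ge_block (f : V -> R) (u v : V) : u \in finset.pblock P v ->
  ((f u)%:E <= fspan (partition_matroid P) f v)%E.
Proof.
move=> uv; rewrite /fspan (bigD1 [set u]%SET) /=; last exact: span_block.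
by rewrite big_set1 le_max lexx.
Qed.

(** Charging each element of a block would overcount the weight of the block, so
    it is put on a single representative. *)
Definition concentrate (g : {set V} -> R) (v : V) : R :=
  if [pick u in finset.pblock P v] == Some v then g (finset.pblock P v) else 0.

Lemma concentrate_ge0 (g : {set V} -> R) : (forall B, 0 <= g B) -> forall v, 0 <= concentrate g v.
Proof. by move=> g_ge0 v; rewrite /concentrate; case: ifP. Qed.

Lemma fspan_concentrate g v :
  ((g (finset.pblock P v))%:E <= fspan (partition_matroid P) (concentrate g) v)%E.
Proof.
case pu: [pick u in finset.pblock P v] => [u|]; last first.
  by move: pu; case: pickP => // /(_ v); rewrite mem_block.
have uv : u \in finset.pblock P v by move: pu; case: pickP => // x + [<-].
apply: le_trans (fspan_ge_block _ uv).
by rewrite /concentrate (finset.same_pblock trivP uv) pu eqxx.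
Qed.

Lemma sum_concentrate (g : {set V} -> R) : (forall B, 0 <= g B) ->
  \sum_v concentrate g v <= \sum_B g B.
Proof.
move=> g_ge0; pose h v (B : {set V}) : R := if [pick u in B] == Some v then g B else 0.
apply: (@le_trans _ _ (\sum_v \sum_(B : {set V}) h v B)).
  apply: ler_sum => v _; rewrite (bigD1 (finset.pblock P v)) //= lerDl.
  by apply: sumr_ge0 => B _; rewrite /h; case: ifP.
rewrite exchange_big; apply: ler_sum => B _; rewrite /h -big_mkcond /=.
case: pickP => [u _|_]; last by rewrite big_pred0.
rewrite (big_pred1 u) // => v; rewrite /= eq_sym; exact: (inj_eq (@Some_inj _)).
Qed.

End PartitionMatroids.

Unset Implicit Arguments.

Theorem corollary10p22 (R : realType) (V : finType) (k : nat) (k_ge2 : (2 <= k)%N)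
    (L : 'I_k -> {set {set V}}) (L_pm : forall i, is_partition_matroid (L i))
    (w : V -> R) (w_ge0 : forall v, 0 <= w v) :
  tau_bar L w <= (k%:R - 1) * nu_bar L w.
Proof.
have [P partP LE] := fin_all_exists2 L_pm.
pose c i v := finset.pblock (P i) v.
have [|g [g_ge0 gw gsum]] := @fractional_cover R V _ k c k_ge2 w (nu_bar L w).
  move=> S mS; apply: (@le_bigmax_cond _ _ _ _ _ _ (fun S : {set V} => \sum_(v in S) w v)).
  apply/forallP => i; rewrite LE; apply: independent_blocks => // u v uS vS uv.
  by apply: mS => //; apply/existsP; exists i; apply/eqP.
apply: le_trans gsum.
have [|_ tau_min] := @tau_bar_min R V k L w _ w_ge0; first exact: ltnW.
apply: (le_trans (tau_min (fun i => concentrate (P i) (g i)) _)).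
  split=> [i v|v]; first exact: concentrate_ge0.
  apply: (@le_trans _ _ (\sum_(i < k) (g i (c i v))%:E)%E).
    by rewrite sumEFin lee_fin.
  by apply: lee_sum => i _; rewrite LE; apply: fspan_concentrate.
by apply: ler_sum => i _; apply: sum_concentrate.
Qed.
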